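(* Let $K$ be a field of characteristic $0$, let $n\ge 2$, and let $f=\sum_{i_1,\dots,i_n\ge 0}a_{i_1,\dots,i_n}x_1^{i_1}\cdots x_n^{i_n}\in K[[x_1,\dots,x_n]]$ be D-finite over $K(x_1,\dots,x_n)$. For each $i\in\{1,\dots,n\}$ fix a non-zero operator $L_i\in K[x_1,\dots,x_n]\langle D_{x_i}\rangle$ with $L_i(f)=0$, of order $r_i$ and degree $d_i$, and put $r_f=\max_i r_i$, $d_f=\max_i d_i$. Let $\Delta(f)=\sum_{i\ge 0}a_{i,\dots,i}\,t^i\in K[[t]]$ be the complete diagonal (written in the variable $t=x_n$). Set $$D=n\Bigl(2+\sum_{i=1}^n d_i\Bigr),\qquad N'=(2D+1)^n\prod_{j=1}^n r_j,\qquad N=\frac{(2D+1)^n}{D}\prod_{j=1}^n r_j .$$ Then there exists a non-zero operator $\tilde P\in K[t]\langle D_t\rangle$ with $\tilde P(\Delta(f))=0$, $\deg(\tilde P)\le N'$ and $\operatorname{ord}(\tilde P)\le N$. Moreover, for every $\varepsilon>0$, $N'=O\bigl((2+\varepsilon)^n n^{2n} d_f^n r_f^n\bigr)$ and $N=O\bigl((2+\varepsilon)^n n^{2n-1} d_f^{n-1} r_f^n\bigr)$ when $n$, $d_f$, $r_f$ tend independently to infinity.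
   Context: A series $g\in K[[x_1,\dots,x_n]]$ is D-finite over $K(x_1,\dots,x_n)$ if the $K(x_1,\dots,x_n)$-vector space spanned in $K(x_1,\dots,x_n)\otimes_{K[x_1,\dots,x_n]}K[[x_1,\dots,x_n]]$ by all partial derivatives $D_{x_1}^{\alpha_1}\cdots D_{x_n}^{\alpha_n}(g)$, $\alpha\in\mathbb N^n$, is finite-dimensional; then for each $i$ there is a non-zero annihilating operator in $K[x_1,\dots,x_n]\langle D_{x_i}\rangle$. For an operator $L=\sum_{j=0}^{r}\ell_j D_{x_i}^j$ with polynomial coefficients and $\ell_r\ne0$, its order is $r$ and its degree is the maximum total degree of the $\ell_j$. Here $K[t]\langle D_t\rangle$ is the ring of linear differential operators in $D_t=d/dt$ with polynomial coefficients in $t$. *)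

(* Defs.v *)
From HB Require Import structures.
From mathcomp Require Import all_boot all_order all_algebra.
From mathcomp Require Import mpoly.
From mathcomp Require Import reals.
Set Implicit Arguments. Unset Strict Implicit. Unset Printing Implicit Defensive.
Import Order.TTheory GRing.Theory Num.Theory.
Local Open Scope ring_scope.

Definition mseries (K : fieldType) (n : nat) := 'X_{1..n} -> K.

Definition mpmul (K : fieldType) (n : nat) (p : {mpoly K[n]}) (g : mseries K n)
  : mseries K n :=
  fun m => \sum_(u <- msupp p) (if lem u m then p@_u * g (mnm_sub m u) else 0).

Definition mderiv (K : fieldType) (n : nat) (i : 'I_n) (g : mseries K n)
  : mseries K n :=
  fun m => (m i).+1%:R * g (mnm_add m (mnm1 i)).

Definition mderivs (K : fieldType) (n : nat) (a : 'X_{1..n}) (g : mseries K n)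
  : mseries K n :=
  foldr (fun i h => iter (a i) (mderiv i) h) g (enum 'I_n).

Definition mop_apply (K : fieldType) (n : nat) (i : 'I_n) (L : seq {mpoly K[n]})
  (g : mseries K n) : mseries K n :=
  fun m => \sum_(j < size L) mpmul L`_j (iter j (mderiv i) g) m.

(* order of a normalized operator (last coefficient non-zero) *)
Definition mop_ord (K : fieldType) (n : nat) (L : seq {mpoly K[n]}) : nat := (size L).-1.
Definition mop_deg (K : fieldType) (n : nat) (L : seq {mpoly K[n]}) : nat :=
  \max_(p <- L) (msize p).-1.

(* D-finiteness over K(x_1..x_n): the K(x)-span of all derivatives of g, inside
   K(x) (x) K[[x]], is finite dimensional; unfolded: finitely many derivatives
   D^b g (b in S) span it, i.e. every D^a g equals a K(x)-combination of them,
   i.e. (clearing denominators, K[[x]] being a domain) q * D^a g = sum_b c_b D^b g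
   with q a non-zero polynomial. *)
Definition Dfinite (K : fieldType) (n : nat) (g : mseries K n) : Prop :=
  exists S : seq 'X_{1..n},
    forall a : 'X_{1..n}, exists (q : {mpoly K[n]}) (c : 'X_{1..n} -> {mpoly K[n]}),
      q != 0 /\
      forall m, mpmul q (mderivs a g) m = \sum_(b <- S) mpmul (c b) (mderivs b g) m.

Definition useries (K : fieldType) := nat -> K.

Definition upmul (K : fieldType) (p : {poly K}) (g : useries K) : useries K :=
  fun k => \sum_(j < k.+1) p`_j * g (k - j)%N.

Definition uderiv (K : fieldType) (g : useries K) : useries K :=
  fun k => k.+1%:R * g k.+1.

Definition uop_apply (K : fieldType) (P : seq {poly K}) (g : useries K) : useries K :=
  fun k => \sum_(j < size P) upmul P`_j (iter j (@uderiv K) g) k.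

Definition uop_ord (K : fieldType) (P : seq {poly K}) : nat := (size P).-1.
Definition uop_deg (K : fieldType) (P : seq {poly K}) : nat :=
  \max_(p <- P) (size p).-1.

Definition diagonal (K : fieldType) (n : nat) (f : mseries K n) : useries K :=
  fun k => f [multinom k | _ < n].

Definition Dbound (n : nat) (d : 'I_n -> nat) : nat := (n * (2 + \sum_(i < n) d i))%N.
Definition Nprime (n : nat) (d r : 'I_n -> nat) : nat :=
  ((2 * Dbound d + 1) ^ n * \prod_(j < n) r j)%N.
Definition Nbound (R : realFieldType) (n : nat) (d r : 'I_n -> nat) : R :=
  ((2 * Dbound d + 1) ^ n)%N%:R / (Dbound d)%:R * (\prod_(j < n) r j)%N%:R.

(* Main.v *)
Require Import Defs.
From HB Require Import structures.
From mathcomp Require Import all_boot all_order all_algebra.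
From mathcomp Require Import mpoly.
From mathcomp Require Import reals.
From mathcomp Require Import boolp functions.
From mathcomp Require Import zify ring lra.
Set Implicit Arguments. Unset Strict Implicit. Unset Printing Implicit Defensive.
Import Order.TTheory GRing.Theory Num.Theory.
Local Open Scope ring_scope.

(** Creative telescoping. Fix an index [o] and put [s_i = x_i] for [i <> o] and
    [t = x_1 ... x_n]. The series [F(s, t) = f(s, t / prod s_i) / prod s_i] has
    [Delta(f)] as its coefficient of [prod s_i ^ -1]. Let [l_i] be the leading
    coefficient of [L_i]. The [(N' + 1) (M + 1)^n] series [t^a D^g F] with
    [a <= N'] and all [g_i <= M := N' %/ D], once multiplied by
    [(prod l_i)^(n M)], are combinations of monomials times the derivatives
    [D^b f] with [b_i < r_i], and the exponents of the monomials in [s] and [t]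
    stay in windows of length [(2 D + 1) (M + 1)]. That makes
    [(2 D + 1)^n (M + 1)^n prod r_j = N' (M + 1)^n] elements, so some operator
    free of [s] annihilates [F]. Writing it as
    [sum_alpha D_s^alpha P_alpha(t, D_t)] and taking [alpha] minimal with
    [P_alpha <> 0], the coefficient of [s^(-1-alpha)] is a non-zero multiple of
    [P_alpha (Delta f)]. *)

(** * Linear spans, and linear dependence by counting *)

Section LinearSpan.
Variables (K : fieldType).
Implicit Types V W : lmodType K.

(** Generators are given by a predicate, possibly infinite, so that conditions on exponents and
    orders are carried along linear maps by plain induction. Finiteness enters only when
    counting. *)
Inductive in_span {V} (S : V -> Prop) : V -> Prop :=
| span0 : in_span S 0
| span_cons c v w : S v -> in_span S w -> in_span S (c *: v + w).

Lemma span_gen V (S : V -> Prop) v : S v -> in_span S v.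
Proof. by move=> Sv; rewrite -[v]addr0 -[v]scale1r; apply/span_cons/span0. Qed.

Lemma spanD V (S : V -> Prop) v w : in_span S v -> in_span S w -> in_span S (v + w).
Proof.
by elim=> [|c u v' Su _ IH] Sw; rewrite ?add0r // -addrA; apply/span_cons/IH.
Qed.

Lemma spanZ V (S : V -> Prop) a v : in_span S v -> in_span S (a *: v).
Proof.
elim=> [|c u v' Su _ IH]; first by rewrite scaler0; apply: span0.
by rewrite scalerDr scalerA; apply: span_cons.
Qed.

Lemma spanN V (S : V -> Prop) v : in_span S v -> in_span S (- v).
Proof. by rewrite -scaleN1r; apply: spanZ. Qed.

Lemma span_sum V (S : V -> Prop) (I : Type) (s : seq I) (P : pred I) (F : I -> V) :
  (forall i, P i -> in_span S (F i)) -> in_span S (\sum_(i <- s | P i) F i).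
Proof. by move=> SF; elim/big_ind: _ => //; [apply: span0 | apply: spanD]. Qed.

Lemma span_map V W (f : {linear V -> W}) (S : V -> Prop) (T : W -> Prop) v :
  (forall u, S u -> in_span T (f u)) -> in_span S v -> in_span T (f v).
Proof.
move=> ST; elim=> [|c u w Su _ IH]; first by rewrite linear0; apply: span0.
by rewrite linearP; apply: spanD => //; apply/spanZ/ST.
Qed.

Lemma span_sub V (S T : V -> Prop) v :
  (forall u, S u -> T u) -> in_span S v -> in_span T v.
Proof.
move=> ST; elim=> [|c u w Su _ IH]; first exact: span0.
by apply: span_cons => //; apply: ST.
Qed.

Lemma span_family V (J : finType) (g : J -> V) v :
  in_span (fun x => exists j, x = g j) v -> exists a : J -> K, v = \sum_j a j *: g j.
Proof.
elim=> [|c u w [j ->] _ [a ->]].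
  by exists (fun=> 0); rewrite big1 // => j _; rewrite scale0r.
exists (fun i => (if i == j then c else 0) + a i).
under [RHS]eq_bigr do rewrite scalerDl.
rewrite big_split /=; congr (_ + _).
rewrite (bigD1 j) //= eqxx big1 ?addr0 //.
by move=> i /negbTE->; rewrite scale0r.
Qed.

(** The matrix of coordinates has more rows than columns, so its left kernel contains a non-zero
    row, whose entries give the relation. *)
Lemma linear_dependence V (I J : finType) (g : J -> V) (v : I -> V) :
    (#|J| < #|I|)%N -> (forall i, in_span (fun x => exists j, x = g j) (v i)) ->
  exists c : I -> K, (exists i, c i != 0) /\ \sum_i c i *: v i = 0.
Proof.
move=> ltJI spanv.
have /choice [a va] := fun i => span_family (spanv i).
pose A : 'M[K]_(#|I|, #|J|) := \matrix_(i, j) a (enum_val i) (enum_val j).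
have : kermx A != 0.
  by rewrite kermx_eq0 /row_free neq_ltn (leq_ltn_trans (rank_leq_col A)).
case/rowV0Pn => x /sub_kermxP xA0 /rV0Pn[i0 xi0].
exists (fun i => x 0 (enum_rank i)); split.
  by exists (enum_val i0); rewrite enum_valK.
under eq_bigr do rewrite va scaler_sumr.
rewrite exchange_big big1 //= => j _.
under eq_bigr do rewrite scalerA.
rewrite -scaler_suml [X in X *: _](_ : _ = 0) ?scale0r //.
transitivity ((x *m A) 0 (enum_rank j)); last by rewrite xA0 mxE.
rewrite mxE [RHS](reindex (@enum_rank I)) /=; last first.
  by apply: onW_bij; apply: enum_rank_bij.
by apply: eq_bigr => i _; rewrite mxE !enum_rankK.
Qed.

End LinearSpan.

(** * Formal Laurent series in [x], as functions of the exponent *)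

Section Laurent.
Variables (K : fieldType) (n : nat).
Local Notation expo := {ffun 'I_n -> int}.
Local Notation laurent := (expo -> K^o).
Implicit Types (g : laurent) (c e : expo) (p : {mpoly K[n]}) (i : 'I_n).

Definition unit_expo i : expo := [ffun j => (j == i)%:Z].
Definition expo_of (m : 'X_{1..n}) : expo := [ffun i => (m i)%:Z].

(** Multiplication by the monomial [x^c], negative exponents allowed. *)
Definition shift c g : laurent := fun e => g (e - c).
Definition dx i g : laurent := fun e => (e i + 1)%:~R * g (e + unit_expo i).
Definition mulp p g : laurent := \sum_(u <- msupp p) p@_u *: shift (expo_of u) g.

Definition extend (f : mseries K n) : laurent :=
  fun e => if [forall i, 0 <= e i] then f [multinom `|e i|%N | i < n] else 0.

Lemma laurentD g h e : (g + h) e = g e + h e.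
Proof. by []. Qed.

Lemma laurentZ a g e : (a *: g) e = a * g e.
Proof. by []. Qed.

Lemma shift_is_linear c : linear (shift c).
Proof. by []. Qed.
HB.instance Definition _ c :=
  GRing.isLinear.Build K laurent laurent *:%R (shift c) (shift_is_linear c).

Lemma dx_is_linear i : linear (dx i).
Proof. by move=> a g h; apply/funext => e; rewrite /dx /= mulrDr mulrCA. Qed.
HB.instance Definition _ i :=
  GRing.isLinear.Build K laurent laurent *:%R (dx i) (dx_is_linear i).

Lemma mulp_is_linear p : linear (mulp p).
Proof.
move=> a g h; rewrite /mulp scaler_sumr -big_split /=; apply: eq_bigr => u _.
by rewrite [shift _ _]linearP scalerDr !scalerA mulrC.
Qed.
HB.instance Definition _ p :=
  GRing.isLinear.Build K laurent laurent *:%R (mulp p) (mulp_is_linear p).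

Lemma mulpE p g e : mulp p g e = \sum_(u <- msupp p) p@_u * g (e - expo_of u).
Proof. by rewrite /mulp fct_sumE. Qed.

Lemma shift0 g : shift 0 g = g.
Proof. by apply/funext => e; rewrite /shift subr0. Qed.

Lemma shift_shift c c' g : shift c (shift c' g) = shift (c + c') g.
Proof. by apply/funext => e; rewrite /shift opprD addrA. Qed.

Lemma mulp_shift p c g : mulp p (shift c g) = shift c (mulp p g).
Proof.
rewrite /mulp linear_sum; apply: eq_bigr => u _.
by rewrite linearZ /= !shift_shift addrC.
Qed.

Lemma mulpC p q g : mulp p (mulp q g) = mulp q (mulp p g).
Proof.
rewrite {1}/mulp; under eq_bigr do rewrite -mulp_shift -linearZ.
by rewrite -linear_sum.
Qed.

(** Leibniz rule for [x^c g]. The factor [c i] vanishes exactly when lowering the exponent would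
    make it negative for the first time, which keeps exponents in range later on. *)
Lemma dx_shift i c g :
  dx i (shift c g) = (c i)%:~R *: shift (c - unit_expo i) g + shift c (dx i g).
Proof.
apply/funext => e; rewrite laurentD laurentZ /dx /shift !ffunE.
have -> : e - (c - unit_expo i) = e + unit_expo i - c by rewrite opprB addrA.
have -> : e - c + unit_expo i = e + unit_expo i - c by rewrite addrAC.
by rewrite -mulrDl -rmorphD /=; congr (_%:~R * _); lia.
Qed.

Lemma dx_mulp i p g :
  dx i (mulp p g) = mulp p (dx i g) +
    \sum_(u <- msupp p) (p@_u * (u i)%:R) *: shift (expo_of u - unit_expo i) g.
Proof.
rewrite /mulp linear_sum -big_split /=; apply: eq_bigr => u _.
by rewrite linearZ /= dx_shift scalerDr scalerA ffunE addrC.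
Qed.

Lemma extend_mpmul p (f : mseries K n) : extend (mpmul p f) = mulp p (extend f).
Proof.
apply/funext => e; rewrite mulpE /extend; case: forallP => [e0|Ne0].
  rewrite /mpmul; apply: eq_bigr => u _.
  have -> : (u <= [multinom `|e i|%N | i < n])%MM = [forall i, 0 <= (e - expo_of u) i].
    apply/forallP/forallP => ue i; move: (ue i) (e0 i);
      rewrite !ffunE mnmE /=; lia.
  case: forallP => [ue|]; last by rewrite mulr0.
  congr (_ * f _); apply/mnmP => i; rewrite !mnmE !ffunE.
  by move: (ue i) (e0 i); rewrite !ffunE /=; lia.
rewrite big1 // => u _; case: forallP => [ue|]; last by rewrite mulr0.
by case: Ne0 => i; move: (ue i); rewrite !ffunE /=; lia.
Qed.

Lemma extend_mderiv i (f : mseries K n) : extend (Defs.mderiv i f) = dx i (extend f).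
Proof.
apply/funext => e; rewrite /dx /extend; case: forallP => [e0|Ne0].
  have -> : [forall j, 0 <= (e + unit_expo i) j].
    by apply/forallP => j; move: (e0 j); rewrite !ffunE /=; lia.
  rewrite /Defs.mderiv; congr (_ * f _).
    by rewrite pmulrn; congr (_%:~R); move: (e0 i); rewrite mnmE; lia.
  apply/mnmP => j; rewrite !mnmE !ffunE [i == j]eq_sym; move: (e0 j).
  by case: (j == i) => /=; lia.
case: forallP => [e1|]; last by rewrite mulr0.
(* The exponent enters the non-negative range from outside only when [e i = -1], where the factor is
   zero. *)
suff -> : e i + 1 = 0 by rewrite mul0r.
apply/eqP/contraT => ei; case: Ne0 => j; move: (e1 j) (e1 i); rewrite !ffunE eqxx.
by case: eqVneq => [->|_] /=; move: ei => /eqP; lia.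
Qed.

(** The derivative [D^m] in closed form, with rising factorials as factors; no order among the
    derivations has to be chosen. *)
Definition dx_multi (m : 'X_{1..n}) g : laurent := fun e =>
  (\prod_i \prod_(j < m i) (e i + 1 + j%:Z)%:~R) * g (e + expo_of m).

Lemma dx_multi0 g : dx_multi 0%MM g = g.
Proof.
apply/funext => e; rewrite /dx_multi big1 ?mul1r => [|i _].
  by congr g; apply/ffunP => i; rewrite !ffunE mnmE addr0.
by rewrite mnmE big_ord0.
Qed.

Lemma dx_dx_multi i m g : dx i (dx_multi m g) = dx_multi (m + U_(i))%MM g.
Proof.
apply/funext => e; rewrite /dx /dx_multi mulrA; congr (_ * g _); last first.
  by apply/ffunP => j; rewrite !ffunE mnmDE mnm1E eq_sym PoszD; ring.
rewrite (bigD1 i) //= [RHS](bigD1 i) //= mulrA; congr (_ * _).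
  rewrite mnmDE mnm1E eqxx addn1 big_ord_recl /= addr0; congr (_ * _).
  by apply: eq_bigr => j _; congr (_%:~R); rewrite !ffunE eqxx /= /bump; lia.
apply: eq_bigr => j ji; rewrite mnmDE mnm1E eq_sym (negbTE ji) addn0.
by apply: eq_bigr => k _; rewrite !ffunE (negbTE ji) addr0.
Qed.

(** A bound on the support is what makes multiplication by a polynomial injective: in one variable,
    [1 - x] kills the two-sided series with all coefficients [1]. *)
Definition bounded_below (C : nat) g :=
  forall e, g e != 0 -> forall i, - C%:Z <= e i.

Lemma bounded_below_sum C (I : Type) (s : seq I) (P : pred I) (F : I -> laurent) :
  (forall j, P j -> bounded_below C (F j)) ->
  bounded_below C (\sum_(j <- s | P j) F j).
Proof.
move=> bF; elim/big_ind: _ => // [e|g h bg bh e]; first by rewrite eqxx.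
case: (eqVneq (g e) 0) => [ge0|/bg //]; case: (eqVneq (h e) 0) => [he0|/bh //].
by rewrite laurentD ge0 he0 addr0 eqxx.
Qed.

Lemma bounded_belowZ C a g : bounded_below C g -> bounded_below C (a *: g).
Proof.
move=> bg e age; apply: bg; apply: contraNneq age => ge0.
by rewrite laurentZ ge0 mulr0.
Qed.

Lemma bounded_below_mulp C p g : bounded_below C g -> bounded_below C (mulp p g).
Proof.
move=> bg; apply: bounded_below_sum => u _; apply: bounded_belowZ => e /bg eC i.
by move: (eC i); rewrite !ffunE /=; lia.
Qed.

(* The product of the lowest monomials of the two factors survives. *)
Lemma mulp_eq0 C p g : p != 0 -> bounded_below C g -> mulp p g = 0 -> g = 0.
Proof.
move=> p0 bg pg0; pose at_ (m : 'X_{1..n}) : expo := [ffun i => (m i)%:Z - C%:Z].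
suff g0 m : g (at_ m) = 0.
  apply/funext => e; apply/eqP/contraT => ge0.
  have := g0 [multinom absz (e i + C%:Z)%R | i < n].
  suff -> : at_ [multinom absz (e i + C%:Z)%R | i < n] = e.
    by move/eqP; rewrite (negbTE ge0).
  apply/ffunP => i; rewrite /at_ ffunE mnmE; move: (bg e ge0 i) => /= h; lia.
elim/(well_founded_ind (@ltom_wf n)): m => m IH.
have := congr1 (fun h : laurent => h (at_ (m + mlast p)%MM)) pg0.
rewrite mulpE (bigD1_seq (mlast p)) ?mlast_supp ?msupp_uniq //= big_seq_cond big1.
  have -> : at_ (m + mlast p)%MM - expo_of (mlast p) = at_ m.
    by apply/ffunP => i; rewrite !ffunE mnmDE; lia.
  by rewrite addr0 => /eqP; rewrite mulf_eq0 mcoeff_eq0 mlast_supp //= => /eqP.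
move=> u /andP[up ul].
(* Outside the bound the coefficient is zero. Inside it, [u] lies above [mlast p], so the exponent
   paired with [u] precedes [m] and the induction hypothesis applies. *)
case: (boolP (u <= m + mlast p)%MM) => [uml|Numl]; last first.
  suff /eqP-> : g (at_ (m + mlast p)%MM - expo_of u) == 0 by rewrite mulr0.
  apply: contraNT Numl => /bg eC; apply/mnm_lepP => i.
  by move: (eC i); rewrite !ffunE /=; lia.
have -> : at_ (m + mlast p)%MM - expo_of u = at_ (m + mlast p - u)%MM.
  apply/ffunP => i; rewrite !ffunE mnmBE; move/mnm_lepP/(_ i): uml; lia.
rewrite IH ?mulr0 //.
have lu : (mlast p < u)%O by rewrite lt_neqAle eq_sym ul mlast_lemc.
by rewrite -(ltmc_add2l _ _ u) submK // ltmc_add2r.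
Qed.

End Laurent.

Lemma mnm_ind n (P : 'X_{1..n} -> Prop) :
  P 0%MM -> (forall m i, P m -> P (m + U_(i))%MM) -> forall m, P m.
Proof.
move=> P0 PS m; have [k] := ubnP (mdeg m); elim: k m => // k IH m mk.
have [m0|] := eqVneq (mdeg m) 0%N.
  by suff -> : m = 0%MM by []; apply/eqP; rewrite -mdeg_eq0 m0.
rewrite mdegE sum_nat_eq0 => /forallPn[i]; rewrite /= -lt0n => mi.
have Um : (U_(i) <= m)%MM by rewrite lep1mP -lt0n.
rewrite -(submK Um); apply: PS; apply: IH.
by move: mk; rewrite -{1}(submK Um) mdegD mdeg1 addn1.
Qed.

(** * Reduction of the derivatives of [f] *)

Section Reduction.
Variables (K : fieldType) (n : nat).
Local Notation expo := {ffun 'I_n -> int}.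
Local Notation laurent := (expo -> K^o).
Implicit Types (g : laurent) (c e u : expo) (p : {mpoly K[n]}) (i : 'I_n).

Definition shifted_derivatives (phi : laurent) (X : expo -> Prop)
    (G : 'X_{1..n} -> Prop) : laurent -> Prop :=
  fun v => exists u m, [/\ X u, G m & v = shift u (dx_multi m phi)].

Definition box (k : nat) : expo -> Prop := fun u => forall i, 0 <= u i <= k%:Z.

Lemma boxD k l u c : box k u -> box l c -> box (k + l) (u + c).
Proof. by move=> uk cl i; move: (uk i) (cl i); rewrite ffunE /=; lia. Qed.

Lemma box_msupp p (u : 'X_{1..n}) : u \in msupp p -> box (msize p).-1 (expo_of u).
Proof.
move=> up i; rewrite ffunE; have := msize_mdeg_lt up.
suff : (u i <= mdeg u)%N by lia.
by rewrite mdegE (bigD1 i) //= leq_addr.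
Qed.

Lemma mulp_span phi p k l G v : ((msize p).-1 <= k)%N ->
  in_span (shifted_derivatives phi (box l) G) v ->
  in_span (shifted_derivatives phi (box (k + l)) G) (mulp p v).
Proof.
move=> pk; apply: span_map => _ [c [m [cl Gm ->]]].
rewrite /= /mulp big_seq; apply: span_sum => u up; apply/spanZ/span_gen.
rewrite shift_shift; exists (expo_of u + c), m; split=> //; apply: boxD => //.
move=> i; have /andP[-> /= ui] := box_msupp up i; apply: le_trans ui _.
by rewrite lez_nat.
Qed.

Section Annihilated.
Variables (phi : laurent) (L : 'I_n -> seq {mpoly K[n]}).
Hypothesis L_phi : forall i,
  \sum_(j < size (L i)) mulp (L i)`_j (iter j (dx i) phi) = 0.
Hypothesis L_neq0 : forall i, last 0 (L i) != 0.
Local Notation r i := (mop_ord (L i)).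
Local Notation d i := (mop_deg (L i)).
Local Notation lc i := (last 0 (L i)).
Local Notation span_of X G := (in_span (shifted_derivatives phi X G)).

Lemma size_mop i : size (L i) = (r i).+1.
Proof. by rewrite /mop_ord; case: (L i) (L_neq0 i) => //; rewrite eqxx. Qed.

Lemma msize_mop_deg i j : ((msize (L i)`_j).-1 <= d i)%N.
Proof.
case: (ltnP j (size (L i))) => [ji|ij]; last by rewrite nth_default // msize0.
by rewrite /mop_deg (big_nth 0) big_mkord (leq_bigmax (Ordinal ji)).
Qed.

Lemma msize_lc i : ((msize (lc i)).-1 <= d i)%N.
Proof. by rewrite -nth_last msize_mop_deg. Qed.

Lemma iter_dx i j : iter j (dx i) phi = dx_multi (U_(i) *+ j)%MM phi.
Proof.
elim: j => [|j IH]; first by rewrite mulm0n dx_multi0.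
by rewrite iterS IH dx_dx_multi mulmSr.
Qed.

Lemma dx_span i k m v :
  span_of (box k) (fun m' => (mdeg m' < mdeg m)%N) v ->
  span_of (box k) (fun m' => (mdeg m' < mdeg (m + U_(i))%MM)%N) (dx i v).
Proof.
apply: span_map => _ [u [m' [uk mm' ->]]]; rewrite /= dx_shift; apply: spanD.
  (* A zero exponent of [x_i] yields no term, so lowering never leaves the box. *)
  have [->|ui] := eqVneq (u i) 0; first by rewrite scale0r; apply: span0.
  apply/spanZ/span_gen; exists (u - unit_expo i), m'; split=> //.
    move=> j; move: (uk j) (uk i) (elimN eqP ui); rewrite !ffunE.
    by case: (eqVneq j i) => [->|_] /=; lia.
  by rewrite mdegD mdeg1; lia.
apply/span_gen; exists u, (m' + U_(i))%MM; split=> //; last by rewrite dx_dx_multi.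
by rewrite !mdegD mdeg1; lia.
Qed.

(* Differentiating [L_i f = 0] keeps the leading coefficient [l_i]: every other term,
   including those created by the Leibniz rule, has smaller total order. Hence one
   factor [l_i] is spent for each decrease of the order. *)
Lemma reduce_derivative i (m : 'X_{1..n}) : (r i <= m i)%N ->
  span_of (box (d i)) (fun m' => (mdeg m' < mdeg m)%N) (mulp (lc i) (dx_multi m phi)).
Proof.
(* The derivation [D_i^(r i)] divides [D^m]: the claim is obtained there by solving [L_i f = 0] for
   its leading term, then propagated along the remaining derivations. *)
move=> rm; have Um : (U_(i) *+ r i <= m)%MM.
  apply/mnm_lepP => j; rewrite mulmnE mnm1E.
  by case: eqVneq => [<-|]; rewrite ?mul1n.
rewrite -(submK Um); elim/mnm_ind: (m - _)%MM => [|{rm Um}m0 j].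
  rewrite add0m -iter_dx.
  have := L_phi i; rewrite size_mop big_ord_recr /= -nth_last size_mop /=.
  move/eqP; rewrite addrC addr_eq0 => /eqP->; apply/spanN/span_sum => j _.
  rewrite iter_dx -[d i]addn0; apply: mulp_span; first exact: msize_mop_deg.
  apply/span_gen; exists 0, (U_(i) *+ j)%MM; split; last by rewrite shift0.
    by move=> k; rewrite ffunE.
  by rewrite !mdegMn mdeg1 !mul1n.
rewrite -addmA [(U_(j) + _)%MM]addmC addmA; move: (m0 + _)%MM => m1 /(dx_span j) H.
have -> : mulp (lc i) (dx_multi (m1 + U_(j))%MM phi) =
    dx j (mulp (lc i) (dx_multi m1 phi)) -
   \sum_(u <- msupp (lc i)) ((lc i)@_u * (u j)%:R) *:
      shift (expo_of u - unit_expo j) (dx_multi m1 phi).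
  by rewrite dx_mulp dx_dx_multi addrK.
apply: spanD => //; apply: spanN; rewrite big_seq; apply: span_sum => u up.
have [->|uj] := eqVneq (u j) 0%N; first by rewrite mulr0 scale0r; apply: span0.
apply/spanZ/span_gen; exists (expo_of u - unit_expo j), m1; split=> //.
  move=> k; have ukd : (u k <= d i)%N.
    move: (box_msupp up k) (msize_lc i); rewrite ffunE /= lez_nat.
    exact: leq_trans.
  rewrite -lt0n in uj; move: ukd; rewrite !ffunE.
  by case: (eqVneq k j) => [->|_] /=; lia.
by rewrite mdegD mdeg1; lia.
Qed.

Definition mul_lcs (s : seq 'I_n) g : laurent :=
  foldr (fun i h => mulp (lc i) h) g s.

Lemma mul_lcs_is_linear s : linear (mul_lcs s).
Proof. by move=> a g h; elim: s => //= i s ->; rewrite linearP. Qed.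
HB.instance Definition _ s :=
  GRing.isLinear.Build K laurent laurent *:%R (mul_lcs s) (mul_lcs_is_linear s).

Lemma mul_lcs_shift s c g : mul_lcs s (shift c g) = shift c (mul_lcs s g).
Proof. by elim: s => //= i s ->; rewrite mulp_shift. Qed.

(** Multiplications by polynomials commute, so any chosen factor can be applied first. *)
Lemma mul_lcs_rem s i g : i \in s ->
  mul_lcs s g = mul_lcs (rem i s) (mulp (lc i) g).
Proof.
elim: s => //= j s IH; rewrite inE; case: eqVneq => [->|ij /= si].
  by move=> _; elim: s {IH} => //= k s <-; rewrite mulpC.
by rewrite IH //=.
Qed.

Lemma mul_lcs_span s l G v : span_of (box l) G v ->
  span_of (box (\sum_(i <- s) d i + l)) G (mul_lcs s v).
Proof.
move=> vG; elim: s => [|i s IH]; first by rewrite big_nil.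
by rewrite big_cons -addnA; apply: mulp_span => //; apply: msize_lc.
Qed.

Local Notation dsum := (\sum_(i < n) d i)%N.
Definition mul_all_lcs k g : laurent := iter k (mul_lcs (enum 'I_n)) g.

Lemma mul_all_lcs_is_linear k : linear (mul_all_lcs k).
Proof.
by move=> a g h; elim: k => //= k ->; rewrite [LHS]linearP.
Qed.
HB.instance Definition _ k :=
  GRing.isLinear.Build K laurent laurent *:%R (mul_all_lcs k)
    (mul_all_lcs_is_linear k).

Lemma mul_all_lcs_shift k c g :
  mul_all_lcs k (shift c g) = shift c (mul_all_lcs k g).
Proof. by elim: k => //= k ->; rewrite mul_lcs_shift. Qed.

(** Induction on [k], one round of all leading coefficients at a time. If [m] is not yet reduced,
    one factor of the round lowers the total order; the other factors, and all rounds left over,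
    only enlarge the exponents, by at most [dsum] per round. *)
Lemma reduce_to_box k m : (forall i, 0 < r i)%N -> (mdeg m <= k)%N ->
  span_of (box (k * dsum)) (fun b : 'X_{1..n} => forall i, (b i < r i)%N)
    (mul_all_lcs k (dx_multi m phi)).
Proof.
move=> r_gt0.
have in_box l (b : 'X_{1..n}) : (forall i, b i < r i)%N ->
  span_of (box (l * dsum)) (fun b : 'X_{1..n} => forall i, (b i < r i)%N)
    (mul_all_lcs l (dx_multi b phi)).
  move=> br; elim: l => [|l IH].
    apply/span_gen; exists 0, b; split=> //; last by rewrite shift0.
    by move=> i; rewrite ffunE.
  rewrite mulSn [X in (X + _)%N](_ : _ = \sum_(i <- enum 'I_n) d i)%N.
    exact: mul_lcs_span.
  by rewrite big_enum.
elim: k m => [|k IH] m mk; first by apply: in_box => i; move: mk;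
  rewrite leqn0 mdeg_eq0 => /eqP->; rewrite mnmE.
case: (boolP [forall i, m i < r i]%N) => [/forallP/in_box //|].
case/forallPn => i; rewrite -leqNgt => /reduce_derivative red.
rewrite /mul_all_lcs iterSr (mul_lcs_rem (i := i)) ?mem_enum //.
have := mul_lcs_span (rem i (enum 'I_n)) red.
have -> : (\sum_(j <- rem i (enum 'I_n)) d j + d i = dsum)%N.
  transitivity (\sum_(j <- enum 'I_n) d j)%N; last by rewrite big_enum.
  by rewrite addnC [RHS](big_rem i) ?mem_enum.
rewrite -/(mul_all_lcs k _); apply: (span_map (f := mul_all_lcs k)).
move=> _ [u [m' [ud m'm ->]]].
rewrite [X in in_span _ X]mul_all_lcs_shift.
have m'k : (mdeg m' <= k)%N by lia.
apply: (span_map (K := K) (f := shift u) _ (IH _ m'k)).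
move=> _ [c [b [cl br ->]]]; apply/span_gen; rewrite /= shift_shift.
by exists (u + c), b; split=> //; rewrite mulSn; apply: boxD.
Qed.

(** Cancels the common denominator from a relation: each factor is injective on series bounded
    below, and preserves the bound. *)
Lemma mul_all_lcs_eq0 C k g : bounded_below C g -> mul_all_lcs k g = 0 -> g = 0.
Proof.
move=> bg; elim: k => //= k IH.
have bs s h : bounded_below C h -> bounded_below C (mul_lcs s h).
  by move=> bh; elim: s => //= i s; apply: bounded_below_mulp.
have bk l : bounded_below C (mul_all_lcs l g) by elim: l => //= l; apply: bs.
suff inj s h : bounded_below C h -> mul_lcs s h = 0 -> h = 0.
  by move/(inj _ _ (bk k)).
move=> bh; elim: s => //= i s IHs /(mulp_eq0 (L_neq0 i) (bs s h bh)).
exact: IHs.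
Qed.

End Annihilated.
End Reduction.

(** * The derivations in [s] and [t] *)

Section Twisted.
Variables (K : fieldType) (n : nat) (o : 'I_n).
Local Notation expo := {ffun 'I_n -> int}.
Local Notation laurent := (expo -> K^o).
Implicit Types (g : laurent) (c e u : expo) (i : 'I_n) (m : 'X_{1..n}).

(* A series [G(x)] stands for [prod s_i ^ -1 * G(s, t / prod s_i)]: the exponent [e]
   of [x] is the exponent [e i - e o - 1] of [s_i] and [e o] of [t]. Thus [twist m]
   is the exponent in [x] of [s^m t^(m o)], and [tdx], [tdx_multi] are the derivatives
   with respect to [s] and [t]. *)
Definition twist m : expo :=
  [ffun i => (if i == o then 0 else (m i)%:Z) + (m o)%:Z].

Lemma twist_pivot : twist U_(o) = [ffun=> 1].
Proof. by apply/ffunP => i; rewrite !ffunE !mnm1E eqxx [o == i]eq_sym; case: (i == o). Qed.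

Lemma twist_unit i : i != o -> twist U_(i) = unit_expo i.
Proof.
move=> io; apply/ffunP => j; rewrite !ffunE !mnm1E (negbTE io) [i == j]eq_sym addr0.
by case: (eqVneq j o) => // ->; rewrite eq_sym (negbTE io).
Qed.

Definition tdx i g : laurent := fun e =>
  (if i == o then e o + 1 else e i - e o)%:~R * g (e + twist U_(i)).

Definition tdx_multi m g : laurent := fun e =>
  (\prod_(i | i != o) \prod_(j < m i) (e i - e o + j%:Z)%:~R) *
  (\prod_(j < m o) (e o + 1 + j%:Z)%:~R) * g (e + twist m).

Lemma tdx_is_linear i : linear (tdx i).
Proof.
by move=> a g h; apply/funext => e; rewrite laurentD laurentZ /tdx mulrDr mulrCA.
Qed.
HB.instance Definition _ i :=
  GRing.isLinear.Build K laurent laurent *:%R (tdx i) (tdx_is_linear i).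

Lemma tdx_multi0 g : tdx_multi 0%MM g = g.
Proof.
apply/funext => e; rewrite /tdx_multi big1 => [|i _]; last by rewrite mnmE big_ord0.
rewrite mnmE big_ord0 !mul1r; congr g; apply/ffunP => i.
by rewrite !ffunE !mnmE; case: eqP; rewrite addr0.
Qed.

Lemma tdx_tdx_multi i m g : tdx i (tdx_multi m g) = tdx_multi (m + U_(i))%MM g.
Proof.
apply/funext => e; rewrite /tdx /tdx_multi mulrA; congr (_ * g _); last first.
  apply/ffunP => j; rewrite !ffunE !mnmDE !mnm1E.
  by case: (j == o); lia.
have [->|io] := eqVneq i o.
  rewrite mulrCA; congr (_ * _).
    apply: eq_bigr => j jo; rewrite mnmDE mnm1E eq_sym (negbTE jo) addn0.
    apply: eq_bigr => k _; congr (_%:~R); rewrite !ffunE !mnm1E eqxx (negbTE jo).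
    by rewrite [o == j]eq_sym (negbTE jo) /=; lia.
  rewrite mnmDE mnm1E eqxx addn1 big_ord_recl /= addr0; congr (_ * _).
  by apply: eq_bigr => k _; congr (_%:~R); rewrite !ffunE !mnm1E eqxx /= /bump; lia.
rewrite mulrA; congr (_ * _); last first.
  rewrite mnmDE mnm1E (negbTE io) addn0; apply: eq_bigr => k _.
  by rewrite !ffunE !mnm1E eqxx (negbTE io) !addr0.
rewrite (bigD1 i) //= [RHS](bigD1 i) //= mulrA; congr (_ * _).
  rewrite mnmDE mnm1E eqxx addn1 big_ord_recl /= addr0; congr (_ * _).
  apply: eq_bigr => k _; congr (_%:~R).
  by rewrite !ffunE !mnm1E !eqxx (negbTE io) /= /bump; lia.
apply: eq_bigr => j /andP[jo ji]; rewrite mnmDE mnm1E eq_sym (negbTE ji) addn0.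
apply: eq_bigr => k _; congr (_%:~R).
by rewrite !ffunE !mnm1E eqxx (negbTE jo) (negbTE io) [i == j]eq_sym (negbTE ji) /=; lia.
Qed.

Lemma tdx_shift i c g : tdx i (shift c g) =
  (if i == o then c o else c i - c o)%:~R *: shift (c - twist U_(i)) g +
  shift c (tdx i g).
Proof.
apply/funext => e; rewrite laurentD laurentZ /tdx /shift !ffunE.
have -> : e - (c - twist U_(i)) = e + twist U_(i) - c by rewrite opprB addrA.
have -> : e - c + twist U_(i) = e + twist U_(i) - c by rewrite addrAC.
by rewrite -mulrDl -rmorphD /=; congr (_%:~R * _); case: eqP; lia.
Qed.

(** Chain rule: [d/dt] is [x_o / (x_1 ... x_n)] times [d/dx_o], and for [i <> o], [d/ds_i] is
    [d/dx_i - (x_o / x_i) d/dx_o - 1 / x_i], the last term coming from the prefactor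
    [prod s_i ^ -1]. *)
Lemma tdxE i g : tdx i g =
  if i == o then shift (unit_expo o - twist U_(o)) (dx o g)
  else dx i g - shift (unit_expo o - unit_expo i) (dx o g) - shift (- unit_expo i) g.
Proof.
have [->|io] := eqVneq i o; apply/funext => e.
  rewrite /tdx /shift /dx eqxx !ffunE mnm1E !eqxx; congr (_%:~R * g _).
    by rewrite /=; lia.
  by apply/ffunP => j; rewrite !ffunE; lia.
rewrite /tdx (negbTE io) twist_unit //.
transitivity (dx i g e - shift (unit_expo o - unit_expo i) (dx o g) e -
   shift (- unit_expo i) g e) => //.
rewrite /shift /dx opprK.
have -> : e - (unit_expo o - unit_expo i) + unit_expo o = e + unit_expo i.
  by apply/ffunP => j; rewrite !ffunE; lia.
rewrite !ffunE eqxx [o == i]eq_sym (negbTE io) /=; move: (g _) => y.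
rewrite -[X in _ = _ - X]mul1r -!mulrBl; congr (_ * _).
by rewrite !(rmorphB, rmorphD) /=; ring.
Qed.

(** In [x^u] the exponent of [t] is [u o] and that of [s_i] is [u i - u o]. One derivation raises
    the former by at most one and lowers the latter by at most two, the extreme case being
    [(x_o / x_i) d/dx_o]. *)
Definition strip (k : nat) : expo -> Prop := fun u =>
  0 <= u o <= k%:Z /\ forall i, - (2 * k)%:Z <= u i - u o <= 0.

Lemma tdx_multi_span phi m :
  in_span (shifted_derivatives phi (strip (mdeg m)) (fun m' => (mdeg m' <= mdeg m)%N))
    (tdx_multi m phi).
Proof.
elim/mnm_ind: m => [|m i IH].
  apply: span_gen; exists 0, 0%MM; split=> //; last by rewrite shift0 dx_multi0 tdx_multi0.
  by rewrite mdeg0; split=> [|i]; rewrite !ffunE.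
rewrite -tdx_tdx_multi mdegD mdeg1 addn1; apply: (span_map (f := tdx i)) IH.
move=> _ [u [m' [[uo us] m'm ->]]] /=; rewrite tdx_shift; apply: spanD.
  have [io|io] := eqVneq i o.
    (* [d/dt] kills the zeroth power of [t], so the exponent of [t] stays non-negative. *)
    have [->|uo0] := eqVneq (u o) 0; first by rewrite scale0r; apply: span0.
    apply/spanZ/span_gen; exists (u - twist U_(i)), m'; split=> //; last by lia.
    rewrite io twist_pivot; split=> [|j]; first by rewrite !ffunE /=; move/eqP: uo0; lia.
    by move: (us j); rewrite !ffunE /=; lia.
  apply/spanZ/span_gen; exists (u - twist U_(i)), m'; split=> //; last by lia.
  rewrite twist_unit //; split=> [|j]; last move: (us j).
    by rewrite !ffunE [o == i]eq_sym (negbTE io) /=; lia.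
  by rewrite !ffunE [o == i]eq_sym (negbTE io); case: (j == i) => /=; lia.
rewrite tdxE; have [io|io] := eqVneq i o.
  rewrite twist_pivot shift_shift; apply/span_gen.
  exists (u + (unit_expo o - [ffun=> 1])), (m' + U_(o))%MM; split.
  - split=> [|j]; last move: (us j); rewrite !ffunE eqxx /=; first by lia.
    by case: (eqVneq j o) => [->|jo] /=; lia.
  - by rewrite mdegD mdeg1; lia.
  - by rewrite dx_dx_multi.
rewrite !linearB /= !shift_shift !dx_dx_multi.
apply: spanD; [apply: spanD|]; [|apply: spanN|apply: spanN]; apply/span_gen.
- exists u, (m' + U_(i))%MM; split=> //; last by rewrite mdegD mdeg1; lia.
  by split=> [|j]; [|move: (us j)]; lia.
- exists (u + (unit_expo o - unit_expo i)), (m' + U_(o))%MM; split=> //.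
    split=> [|j]; last move: (us j); rewrite !ffunE !eqxx [o == i]eq_sym (negbTE io) /=.
      by lia.
    by case: (j == o) (j == i) => [] [] /=; lia.
  by rewrite mdegD mdeg1; lia.
- exists (u - unit_expo i), m'; split=> //; last by lia.
  split=> [|j]; last move: (us j); rewrite !ffunE [o == i]eq_sym (negbTE io) /=.
    by lia.
  by case: (j == i) => /=; lia.
Qed.

End Twisted.

(** * Existence of a telescoper by counting *)

Section Telescoping.
Variables (K : fieldType) (n : nat) (o : 'I_n).
Local Notation expo := {ffun 'I_n -> int}.
Local Notation laurent := (expo -> K^o).
Implicit Types (g : laurent) (c e u : expo) (i : 'I_n).

Definition const_expo (a : nat) : expo := [ffun=> a%:Z].
Definition mnm_of M (w : {ffun 'I_n -> 'I_M}) : 'X_{1..n} := [multinom w i : nat | i < n].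

(** The strip for order [k], enlarged by [a] for powers of [t] and by [s] for the monomials of the
    denominators. *)
Definition window (a k s : nat) : expo -> Prop := fun u =>
  0 <= u o <= (a + k + s)%:Z /\ forall i, - (2 * k + s)%:Z <= u i - u o <= s%:Z.

(** An exponent is coded by its [t]-part at coordinate [o] and by its [s_i]-parts, translated by
    [2 * k + s], elsewhere. All codes lie in [0..B], which leaves [(B + 1)^n * prod r_i] indices. *)
Lemma window_span phi (r : 'I_n -> nat) a k s B (v : laurent) :
    (a + k + s <= B)%N -> (2 * k + 2 * s <= B)%N ->
    in_span (shifted_derivatives phi (window a k s)
            (fun b : 'X_{1..n} => forall i, (b i < r i)%N)) v ->
  in_span (fun x : laurent => exists j :
       {ffun 'I_n -> 'I_B.+1} * {dffun forall i, 'I_(r i)},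
     x = shift [ffun i => (j.1 o : nat)%:Z +
                    (if i == o then 0 else (j.1 i : nat)%:Z - (2 * k + s)%:Z)]
               (dx_multi [multinom j.2 i : nat | i < n] phi)) v.
Proof.
move=> aB kB; apply: span_sub => _ [u [b [[uo us] br ->]]].
exists ([ffun i => inord (absz (if i == o then u o else u i - u o + (2 * k + s)%:Z))],
        [ffun i => Ordinal (br i)]) => /=.
congr (shift _ (dx_multi _ phi)); last by apply/mnmP => i; rewrite mnmE ffunE.
apply/ffunP => i; rewrite !ffunE eqxx inordK; last by lia.
case: (eqVneq i o) => [->|io].
  by rewrite addr0; case/andP: uo => uo _; rewrite gez0_abs.
by move: (us i) uo => /=; move: (u i) (u o) => x y xy y0; rewrite inordK; lia.
Qed.

Lemma bounded_below_tdx_multi (phi : laurent) C m : bounded_below 0 phi ->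
  (forall i, twist o m i <= C%:Z) -> bounded_below C (tdx_multi o m phi).
Proof.
move=> bphi mC e; rewrite /tdx_multi mulf_eq0 negb_or => /andP[_ /bphi ge i].
by move: (ge i) (mC i); rewrite ffunE /=; move: (twist o m i) (e i) => x y; lia.
Qed.

Lemma bounded_below_shift C a g :
  bounded_below C g -> bounded_below C (shift (const_expo a) g).
Proof. by move=> bg e /bg ge i; move: (ge i); rewrite !ffunE /=; lia. Qed.

Variables (phi : laurent) (L : 'I_n -> seq {mpoly K[n]}).
Hypothesis L_phi : forall i,
  \sum_(j < size (L i)) mulp (L i)`_j (iter j (dx i) phi) = 0.
Hypothesis L_neq0 : forall i, last 0 (L i) != 0.
Hypothesis phi_ge0 : bounded_below 0 phi.
Local Notation r i := (mop_ord (L i)).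
Local Notation dsum := (\sum_(i < n) mop_deg (L i))%N.

(** After clearing denominators, the candidates outnumber the generators of a space containing them
    all; the resulting relation survives removal of the denominators. *)
Lemma telescoper_exists N M B :
    (forall i, 0 < r i)%N ->
    (N + n * M + n * M * dsum <= B)%N ->
    (2 * (n * M) + 2 * (n * M * dsum) <= B)%N ->
    (B.+1 ^ n * \prod_i r i < N.+1 * M.+1 ^ n)%N ->
  exists c : 'I_N.+1 * {ffun 'I_n -> 'I_M.+1} -> K,
    (exists x, c x != 0) /\
    \sum_x c x *: shift (const_expo x.1) (tdx_multi o (mnm_of x.2) phi) = 0.
Proof.
(* Every candidate has total order at most [n * M], so that many rounds of leading coefficients
   reduce all of them. *)
move=> r_gt0 NB kB lt_card; set k := (n * M)%N in NB kB.
have mk (w : {ffun 'I_n -> 'I_M.+1}) : (mdeg (mnm_of w) <= k)%N.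
  rewrite mdegE; apply: (@leq_trans (\sum_(i < n) M)%N); last first.
    by rewrite sum_nat_const card_ord.
  by apply: leq_sum => i _; rewrite mnmE -ltnS.
pose v (x : 'I_N.+1 * {ffun 'I_n -> 'I_M.+1}) :=
  shift (const_expo x.1) (tdx_multi o (mnm_of x.2) phi).
have vspan x : in_span (shifted_derivatives phi (window N k (k * dsum))
    (fun b : 'X_{1..n} => forall i, (b i < r i)%N)) (mul_all_lcs L k (v x)).
  rewrite /v mul_all_lcs_shift.
  have /(span_map (K := K) (f := mul_all_lcs L k)) :=
    tdx_multi_span o phi (mnm_of x.2).
  move=> /(_ (shifted_derivatives phi (window 0 k (k * dsum))
    (fun b : 'X_{1..n} => forall i, (b i < r i)%N))) H.
  apply: (span_map (K := K) (f := shift (const_expo x.1)) _ (H _)).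
    move=> _ [u [b [[uo us] br ->]]]; apply/span_gen => /=.
    exists (const_expo x.1 + u), b; split=> //; last by rewrite shift_shift.
    have := ltn_ord x.1; rewrite ltnS => xN.
    split=> [|i]; last move: (us i); rewrite !ffunE /= => *; last by lia.
    by move: uo xN; move: (k * dsum)%N (u o) (nat_of_ord x.1) => s y a; clear; lia.
  move=> _ [u [m [[uo us] mm ->]]]; rewrite /= mul_all_lcs_shift.
  have mx := mk x.2.
  have mk' := leq_trans mm mx.
  apply: (span_map (K := K) (f := shift u) _ (reduce_to_box L_phi L_neq0 r_gt0 mk')).
  move=> _ [c [b [cb br ->]]]; apply/span_gen => /=.
  exists (u + c), b; split=> //; last by rewrite shift_shift.
  split=> [|i]; rewrite !ffunE /=.
    move: (cb o) uo mx; move: (k * dsum)%N (mdeg _) (u o) (c o) => s q y z.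
    by clear; lia.
  move: (us i) (cb i) (cb o) mx; move: (k * dsum)%N (mdeg _) => s q.
  by move: (u i) (u o) (c i) (c o) => y z y' z'; clear; lia.
have [|c [c0 cv]] := linear_dependence (I := ('I_N.+1 * {ffun 'I_n -> 'I_M.+1})%type) _
    (fun x => window_span NB kB (vspan x)).
  rewrite !card_prod !card_ffun !card_ord card_dep_ffun.
  rewrite foldrE big_map big_enum /=.
  by under eq_bigr do rewrite card_ord.
exists c; split=> //.
have := cv; under eq_bigr do rewrite -linearZ.
(* The support bound is [2 * k] because [twist] adds up to two components of the multi-index, each
   at most [k]. *)
rewrite -linear_sum; apply: (@mul_all_lcs_eq0 _ _ _ L_neq0 (2 * k)%N).
apply: bounded_below_sum => x _; apply/bounded_belowZ/bounded_below_shift.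
apply: bounded_below_tdx_multi => // i; rewrite /twist ffunE.
have ui j : (mnm_of x.2 j <= k)%N.
  by apply: leq_trans (mk x.2); rewrite mdegE (bigD1 j) //= leq_addr.
move: (ui i) (ui o); move: (mnm_of _ i) (mnm_of _ o) => a b.
by case: (i == o); clear; lia.
Qed.
End Telescoping.

(** * From a telescoper to an operator for the diagonal *)

Section DiagonalOperator.
Variable K : fieldType.

Lemma operator_of_recurrence N M (c : nat -> nat -> K) (g : useries K) :
    (exists a b, [/\ (a <= N)%N, (b <= M)%N & c a b != 0]) ->
    (forall k, \sum_(b < M.+1) \sum_(a < N.+1)
        (if (a <= k)%N then c a b * iter b (@uderiv K) g (k - a)%N else 0) = 0) ->
  exists P : seq {poly K}, [/\ last 0 P != 0, (forall k, uop_apply P g k = 0),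
    (uop_deg P <= N)%N & (uop_ord P <= M)%N].
Proof.
move=> [a0 [b0 [a0N b0M c0]]] rec.
(* Polynomials are stored without trailing zeros, so the last coefficient is non-zero as soon as [P]
   is. *)
pose P : {poly {poly K}} := \poly_(b < M.+1) \poly_(a < N.+1) c a b.
have PE b a : P`_b`_a = if (a < N.+1)%N && (b < M.+1)%N then c a b else 0.
  by rewrite coef_poly; case: (b < _)%N; rewrite ?andbF ?coef0 // andbT coef_poly.
have P0 : P != 0.
  apply: contraNneq c0 => P0; have := PE b0 a0.
  by rewrite P0 !coef0 !ltnS a0N b0M /= => <-.
have szP : (size P <= M.+1)%N by apply: size_poly.
exists P; split.
- by rewrite -nth_last -lead_coefE lead_coef_eq0.
- move=> k; rewrite -[RHS](rec k) /uop_apply.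
  rewrite (big_ord_widen M.+1 (fun j => upmul P`_j (iter j (@uderiv K) g) k)) //.
  rewrite big_mkcond; apply: eq_bigr => b _.
  have -> : (if (b < size P)%N then upmul P`_b (iter b (@uderiv K) g) k else 0) =
            upmul P`_b (iter b (@uderiv K) g) k.
    case: ltnP => // Pb; rewrite nth_default // /upmul big1 // => a _.
    by rewrite coef0 mul0r.
  rewrite /upmul; pose F a := c a b * iter b (@uderiv K) g (k - a)%N.
  (* The ranges [a <= k] and [a <= N] of the two sides are compared inside a common one. *)
  transitivity (\sum_(a < N.+1 + k.+1 | ((a < N.+1) && (a < k.+1))%N) F a).
    rewrite (big_ord_widen (N.+1 + k.+1)
       (fun a => P`_b`_a * iter b (@uderiv K) g (k - a)%N)) ?leq_addl //.
    rewrite big_mkcond [RHS]big_mkcond; apply: eq_bigr => a _.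
    rewrite PE (ltn_ord b) andbT; case: (a < k.+1)%N; rewrite ?andbF // andbT.
    by case: ifP => //; rewrite mul0r.
  rewrite [RHS](big_ord_widen (N.+1 + k.+1)
     (fun a => if (a <= k)%N then F a else 0)) ?leq_addr //.
  by rewrite -big_mkcondr.
- apply/bigmax_leqP_seq => p /(nthP 0)[b bP <-] _.
  by rewrite coef_poly; case: ifP => _; rewrite ?size_poly0 // -subn1 leq_subLR size_poly.
- by rewrite /uop_ord -subn1 leq_subLR.
Qed.

Lemma iter_uderiv b (g : useries K) k :
  iter b (@uderiv K) g k = (\prod_(j < b) (k + 1 + j)%N%:R) * g (k + b)%N.
Proof.
elim: b k => [|b IH] k; first by rewrite big_ord0 mul1r addn0.
rewrite iterS {1}/uderiv IH mulrA big_ord_recl /= !addn0; congr (_ * _ * g _).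
- by rewrite addn1.
- by apply: eq_bigr => j _; congr (_%:R); rewrite /= /bump; lia.
- by rewrite addSnnS.
Qed.

Lemma extend_bounded_below n (f : mseries K n) : bounded_below 0 (extend f).
Proof.
by move=> e; rewrite /extend; case: forallP => [e0 _ i|]; rewrite ?eqxx // oppr0.
Qed.

Lemma diagonal_extend n (f : mseries K n) (k : nat) :
  extend f (const_expo n k) = diagonal f k.
Proof.
rewrite /extend /diagonal; case: forallP => [_|[]]; last by move=> i; rewrite ffunE.
by congr f; apply/mnmP => i; rewrite !mnmE ffunE.
Qed.

Variables (n : nat) (o : 'I_n) (f : mseries K n).
Hypothesis K0 : [pchar K] =i pred0.

Lemma natr_pos_neq0 k : (k.+1%:R : K) != 0.
Proof. by have -> := (pcharf0P K).1 K0 k.+1. Qed.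

Lemma telescoper_diagonal N M (c : 'I_N.+1 * {ffun 'I_n -> 'I_M.+1} -> K) :
    (exists x, c x != 0) ->
    \sum_x c x *: shift (const_expo n x.1) (tdx_multi o (mnm_of x.2) (extend f)) = 0 ->
  exists P : seq {poly K}, [/\ last 0 P != 0,
    (forall k, uop_apply P (diagonal f) k = 0), (uop_deg P <= N)%N & (uop_ord P <= M)%N].
Proof.
move=> [[a1 w1] c1] rel.
(* [wt] is the total order in [s], and [w0] minimises it among the terms that occur. Varying only
   coordinate [o], [upd] runs through the powers of [D_t] that accompany the [s]-part of [w0]. *)
pose wt (w : {ffun 'I_n -> 'I_M.+1}) := (\sum_(i | i != o) w i)%N.
pose S := [pred w | [exists a, c (a, w) != 0]].
have Sw1 : S w1 by apply/existsP; exists a1.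
case: (arg_minnP wt Sw1) => w0 /existsP[a0 ca0] wmin.
pose upd (b : 'I_M.+1) : {ffun 'I_n -> 'I_M.+1} :=
  [ffun i => if i == o then b else w0 i].
have upd0 : upd (w0 o) = w0 by apply/ffunP => i; rewrite ffunE; case: eqP => // ->.
apply: (operator_of_recurrence (c := fun a b => c (inord a, upd (inord b)))).
  exists a0, (w0 o); split; [by rewrite -ltnS|by rewrite -ltnS|].
  by rewrite !inord_val upd0.
(* This is the exponent [-1 - w0 i] of each [s_i] and [k] of [t]. *)
move=> k; pose e : {ffun 'I_n -> int} :=
  [ffun i => if i == o then k%:Z else k%:Z - (w0 i : nat)%:Z].
have /eqP := congr1 (fun h : _ -> K^o => h e) rel.
rewrite fct_sumE /= => /eqP rel_e.
(* The scalar that the [s]-derivations of [w0] produce at [e]; it is non-zero in characteristic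
   zero. *)
pose C := \prod_(i | i != o) \prod_(j < w0 i) (- (w0 i : nat)%:Z + j%:Z)%:~R : K.
have C0 : C != 0.
  apply/prodf_neq0 => i _; apply/prodf_neq0 => j _.
  have -> : - (w0 i : nat)%:Z + j%:Z = - (w0 i - j).-1.+1%:Z.
    by have := ltn_ord j; lia.
  by rewrite rmorphN oppr_eq0 /= natr_pos_neq0.
apply: (mulfI C0); rewrite mulr0 -[RHS]rel_e.
have in_S w : w \in S \/ forall a, c (a, w) = 0.
  case: (boolP (w \in S)) => [|NS]; [by left | right=> a].
  by apply/eqP; apply: contraNT NS => caw; apply/existsP; exists a.
(* A term that occurs with another [s]-part has [w0 i < w i] for some [i], by minimality of [wt w0];
   its product for that [i] contains the zero factor [j = w0 i]. *)
have vanish a (w : {ffun 'I_n -> 'I_M.+1}) : upd (w o) != w ->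
    c (a, w) * shift (const_expo n a) (tdx_multi o (mnm_of w) (extend f)) e = 0.
  move=> updw; case: (in_S w) => [Sw|->]; last by rewrite mul0r.
  suff [i io wi] : exists2 i, i != o & (w0 i < w i)%N.
    rewrite /shift /tdx_multi (bigD1 i) //= mnmE (bigD1 (Ordinal wi)) //=.
    rewrite !ffunE eqxx (negbTE io).
    rewrite [X in X%:~R](_ : _ = 0) ?mul0r ?mulr0 //. ring.
  apply/exists_inP; apply: contraNT updw; rewrite negb_exists_in => /forall_inP wle.
  have {}wle i : i != o -> (w i <= w0 i)%N by move/wle; rewrite -leqNgt.
  have wt_eq : wt w = wt w0.
    by apply/eqP; rewrite eqn_leq (wmin _ Sw) andbT; apply: leq_sum.
  have := leqif_sum (fun i (io : i != o) => leqif_eq (wle i io)).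
  rewrite -[X in (X <= _ ?= iff _)%N]/(wt w) -[X in (_ <= X ?= iff _)%N]/(wt w0).
  case=> _; rewrite wt_eq eqxx => /esym/forall_inP eqw.
  apply/eqP/ffunP => i; rewrite ffunE; case: eqVneq => [->//|io].
  by apply/val_inj/esym/eqP/eqw.
pose T a w := c (a, w) * shift (const_expo n a) (tdx_multi o (mnm_of w) (extend f)) e.
transitivity (\sum_(a < N.+1) \sum_w T a w); last first.
  by rewrite pair_big /=; apply: eq_bigr => -[].
rewrite exchange_big mulr_sumr /=; apply: eq_bigr => a _.
rewrite (bigID (fun w : {ffun 'I_n -> 'I_M.+1} => upd (w o) == w)) /=.
rewrite [X in _ + X]big1 ?addr0; last first.
  by move=> w; apply: vanish.
rewrite (reindex_onto upd (fun w : {ffun 'I_n -> 'I_M.+1} => w o)) /=; last first.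
  by move=> w /eqP.
rewrite mulr_sumr; apply: eq_big => [b|b _].
  by rewrite !ffunE !eqxx.
have eo : (e - const_expo n a) o = k%:Z - (a : nat)%:Z by rewrite !ffunE eqxx.
have ei i : i != o -> (e - const_expo n a) i = k%:Z - (a : nat)%:Z - (w0 i : nat)%:Z.
  by move=> io; rewrite !ffunE (negbTE io) /=; ring.
have updo : mnm_of (upd b) o = b by rewrite mnmE ffunE eqxx.
have updi i : i != o -> mnm_of (upd b) i = w0 i.
  by move=> io; rewrite mnmE ffunE (negbTE io).
have -> : T a (upd b) = C * (c (a, upd b) *
    ((\prod_(j < b) (k%:Z - (a : nat)%:Z + 1 + j%:Z)%:~R) *
     extend f [ffun=> k%:Z - (a : nat)%:Z + (b : nat)%:Z])).
  rewrite /T /shift /tdx_multi eo updo -mulrA [RHS]mulrCA.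
  congr (_ * (_ * (_ * extend f _))).
    apply: eq_bigr => i io; rewrite updi //.
    by apply: eq_bigr => j _; rewrite ei //; congr (_%:~R); ring.
  apply/ffunP => i; rewrite !ffunE updo.
  by case: (eqVneq i o) => [_|io]; rewrite ?updi //; ring.
congr (_ * _); rewrite !inord_val; case: leqP => [ak|ka].
  rewrite iter_uderiv -diagonal_extend; congr (_ * (_ * extend f _)).
    apply: eq_bigr => j _; rewrite -[LHS]/(((k - a + 1 + j)%N%:Z)%:~R).
    by congr (_%:~R); lia.
  by apply/ffunP => i; rewrite !ffunE; lia.
(* At the negative index [k - a], either the factor [j = a - k - 1] is zero or the exponent
   [k - a + b] is still negative. *)
apply/esym; have [ab|ba] := ltnP (a - k.+1) b.
  rewrite (bigD1 (Ordinal ab)) //= [X in X%:~R](_ : _ = 0) ?mul0r ?mulr0 //.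
  by lia.
rewrite [extend f _](_ : _ = 0) ?mulr0 // /extend.
case: forallP => // /(_ o); rewrite ffunE; lia.
Qed.

End DiagonalOperator.

(** * The operator for the diagonal, with its bounds *)

Lemma extend_mop_apply (K : fieldType) n i (L : seq {mpoly K[n]}) (f : mseries K n) :
  extend (mop_apply i L f) =
  \sum_(j < size L) mulp L`_j (iter j (dx i) (extend f)).
Proof.
have iterE j : iter j (dx i) (extend f) = extend (iter j (Defs.mderiv i) f).
  by elim: j => //= j ->; rewrite extend_mderiv.
apply/funext => e; rewrite fct_sumE.
under eq_bigr do rewrite iterE -extend_mpmul.
by rewrite /extend; case: forallP => // _; rewrite big1.
Qed.

Lemma extend_eq0 (K : fieldType) n (f : mseries K n) :
  extend f = 0 -> forall k, diagonal f k = 0.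
Proof. by move=> f0 k; rewrite -diagonal_extend f0. Qed.

Lemma diagonal_operator (K : fieldType) n (f : mseries K n)
    (L : 'I_n -> seq {mpoly K[n]}) :
    [pchar K] =i pred0 -> (2 <= n)%N -> (forall i, last 0 (L i) != 0) ->
    (forall i m, mop_apply i (L i) f m = 0) ->
    let r := fun i => mop_ord (L i) in
    let d := fun i => mop_deg (L i) in
  exists P : seq {poly K}, [/\ last 0 P != 0,
    (forall k, uop_apply P (diagonal f) k = 0), (uop_deg P <= Nprime d r)%N &
    (uop_ord P <= Nprime d r %/ Dbound d)%N].
Proof.
move=> K0 n2 L0 Lf r d.
have L_phi i : \sum_(j < size (L i)) mulp (L i)`_j (iter j (dx i) (extend f)) = 0.
  rewrite -extend_mop_apply; apply/funext => e.
  by rewrite /extend; case: ifP => // _; rewrite Lf.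
(* An operator of order zero reads [l_i f = 0] and forces [f = 0]; the operator [1] then serves. *)
case: (boolP [forall i, 0 < r i]%N) => [/forallP r_gt0|/forallPn[i]]; last first.
  rewrite -eqn0Ngt => /eqP ri0.
  have f0 : extend f = 0.
    apply: (mulp_eq0 (L0 i) (extend_bounded_below (f := f))).
    have := L_phi i; rewrite (size_mop L0) -/(r i) ri0 big_ord1 /=.
    by rewrite -nth_last (size_mop L0) -/(r i) ri0.
  exists [:: 1]; split; rewrite ?oner_neq0 //.
    move=> k; rewrite /uop_apply big_ord1 /upmul big1 // => j _.
    by rewrite /= extend_eq0 // mulr0.
  by rewrite /uop_deg big_seq1 size_poly1.
set D := Dbound d; set N := Nprime d r; set M := (N %/ D)%N.
set S := (\sum_(i < n) d i)%N.
have DE : D = (n * (2 + S))%N by [].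
have D_gt0 : (0 < D)%N by rewrite DE muln_gt0; lia.
have NE : N = ((2 * D + 1) ^ n * \prod_(j < n) r j)%N by [].
have ltN : (N < D * M.+1)%N by rewrite mulnC; apply: ltn_ceil.
have DM : (n * M + n * M * S + n * M <= D * M)%N by rewrite DE; lia.
pose o : 'I_n := Ordinal (ltnW n2).
(* Since [N < D (M + 1)] and [n M + n M S <= D M], the exponents of [t] and of every [s_i] fit in
   [(2 D + 1) (M + 1)] values. *)
pose B := (((2 * D + 1) * M.+1).-1)%N.
have BE : B.+1 = ((2 * D + 1) * M.+1)%N by rewrite /B prednK // muln_gt0 addn1.
have [||//|c [c0 rel]] := telescoper_exists o L_phi L0 (extend_bounded_below (f := f))
  (N := N) (M := M) (B := B) r_gt0.
- by rewrite -/S -ltnS BE; lia.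
- by rewrite -/S -ltnS BE; lia.
(* There are [N (M + 1)^n] generators against [(N + 1) (M + 1)^n] candidates. *)
- rewrite BE expnMn mulnAC -NE.
  by rewrite ltn_mul2r expn_gt0 /= ltnS.
exact: (telescoper_diagonal K0 c0 rel).
Qed.

(** * Asymptotics of the bounds *)

Lemma Dbound_le n (d : 'I_n -> nat) :
  (Dbound d <= n * (2 + n * \max_(i < n) d i))%N.
Proof.
rewrite leq_mul2l leq_add2l; apply/orP; right.
apply: (@leq_trans (\sum_(i < n) \max_(i < n) d i)%N).
  by apply: leq_sum => i _; apply: leq_bigmax.
by rewrite sum_nat_const card_ord.
Qed.

Lemma prod_le_max n (r : 'I_n -> nat) :
  (\prod_(i < n) r i <= (\max_(i < n) r i) ^ n)%N.
Proof.
apply: (@leq_trans (\prod_(i < n) \max_(i < n) r i)%N).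
  by apply: leq_prod => i _; apply: leq_bigmax.
by rewrite prod_nat_const card_ord.
Qed.

Lemma bounds_asymptotic (R : realType) (eps : R) : 0 < eps ->
  exists (C : R) (M : nat), forall (n : nat) (d r : 'I_n -> nat),
    let df := (\max_(i < n) d i)%N in
    let rf := (\max_(i < n) r i)%N in
    (M <= n)%N -> (M <= df)%N -> (M <= rf)%N ->
    (Nprime d r)%:R <= C * ((2 + eps) ^+ n * (n ^ (2 * n) * df ^ n * rf ^ n)%N%:R) /\
    Nbound R d r <=
      C * ((2 + eps) ^+ n * (n ^ (2 * n - 1) * df ^ (n - 1) * rf ^ n)%N%:R).
Proof.
(* From [D <= n (2 + n df)] follows [2 D + 1 <= 2 n^2 df + 5 n]; the threshold gives [5 <= eps n],
   so the excess is at most [eps n^2 df]. The constant [3] bounds [(2 D + 1) / D]. *)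
move=> eps0; exists 3, (Num.truncn (5 / eps)).+1 => n d r df rf Mn Mdf Mrf.
have n_gt0 : (0 < n)%N by apply: leq_trans Mn.
have df_gt0 : (0 < df)%N by apply: leq_trans Mdf.
have n1 : 1 <= n%:R :> R by rewrite ler1n.
have df1 : 1 <= df%:R :> R by rewrite ler1n.
have eps_n : 5 <= eps * n%:R.
  rewrite mulrC -ler_pdivrMr //; apply: ltW (lt_le_trans (truncnS_gt _) _).
  by rewrite ler_nat.
have D_gt0 : (0 < Dbound d)%N by rewrite muln_gt0 n_gt0.
set D := Dbound d in D_gt0 *.
have E2 : 0 < 2 + eps by lra.
have base : (2 * D + 1)%N%:R <= (2 + eps) * (n ^ 2 * df)%N%:R :> R.
  have DR : D%:R <= n%:R * (2 + n%:R * df%:R) :> R.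
    by rewrite -natrM -natrD -natrM ler_nat Dbound_le.
  rewrite natrD natrM [(n ^ 2 * df)%:R]natrM natrX.
  have : 5 * n%:R <= eps * n%:R * n%:R * df%:R.
    rewrite -[X in X <= _]mulr1; apply: ler_pM => //; first by lra.
    by rewrite ler_wpM2r.
  nra.
have prodr : (\prod_(j < n) r j)%N%:R <= (rf ^ n)%N%:R :> R by rewrite ler_nat prod_le_max.
have powE k : ((2 + eps) * (n ^ 2 * df)%N%:R) ^+ k =
    (2 + eps) ^+ k * (n ^ (2 * k) * df ^ k)%N%:R :> R.
  by rewrite exprMn -natrX expnMn expnM.
split.
  rewrite /Nprime natrM natrX -/D.
  have le1 : (2 * D + 1)%N%:R ^+ n * (\prod_(j < n) r j)%N%:R <=
      (2 + eps) ^+ n * (n ^ (2 * n) * df ^ n * rf ^ n)%N%:R :> R.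
    rewrite natrM mulrA -powE; apply: ler_pM => //; first by rewrite exprn_ge0.
    by rewrite lerXn2r // nnegrE ?(le_trans _ base).
  apply: (le_trans le1); rewrite ler_peMl ?ler1n //.
  by rewrite mulr_ge0 // exprn_ge0 // ltW.
rewrite /Nbound -/D natrX.
(* One of the [n] factors [2 D + 1] is absorbed by the division by [D], which leaves the power
   [k = n - 1]. *)
have [k nk] : exists k, n = k.+1 by exists n.-1; rewrite prednK.
have D3 : (2 * D + 1)%N%:R / D%:R <= 3 :> R.
  rewrite ler_pdivrMr ?ltr0n // -natrM ler_nat; lia.
have leX : (2 * D + 1)%N%:R ^+ k <= ((2 + eps) * (n ^ 2 * df)%N%:R) ^+ k :> R.
  by rewrite lerXn2r // nnegrE ?(le_trans _ base).
apply: (@le_trans _ _ (3 * ((2 + eps) ^+ k * (n ^ (2 * k) * df ^ k * rf ^ n)%N%:R))).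
  have -> : (2 * D + 1)%N%:R ^+ n = (2 * D + 1)%N%:R ^+ k * (2 * D + 1)%N%:R :> R.
    by rewrite [in LHS]nk exprSr.
  rewrite natrM [(2 + eps) ^+ k * _]mulrA -powE.
  rewrite -[_ * _ / _]mulrA [_ ^+ k * (_ / _)]mulrC -[X in X <= _]mulrA.
  apply: ler_pM => //.
  - by rewrite divr_ge0.
  - by rewrite mulr_ge0 // exprn_ge0.
  by apply: ler_pM => //; rewrite exprn_ge0.
rewrite ler_pM2l // [in X in _ <= X]nk subn1 /=.
apply: ler_pM; rewrite ?exprn_ge0 ?(ltW E2) //.
  by rewrite -nk nk exprS ler_peMl ?exprn_ge0 ?(ltW E2) //; lra.
(* The power [n^(2 k)] obtained is below the allowed [n^(2 n - 1)] by a factor [n]. *)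
rewrite ler_nat !leq_mul // -nk leq_pexp2l //; lia.
Qed.

Unset Implicit Arguments.

Theorem theorem4p12 (R : realType) (K : fieldType) (n : nat)
  (f : mseries K n) (L : 'I_n -> seq {mpoly K[n]}) :
  [pchar K] =i pred0 ->
  (2 <= n)%N ->
  Dfinite f ->
  (forall i, last 0 (L i) != 0) ->
  (forall i m, mop_apply i (L i) f m = 0) ->
  let r := fun i => mop_ord (L i) in
  let d := fun i => mop_deg (L i) in
  (exists P : seq {poly K},
      [/\ last 0 P != 0,
          (forall k, uop_apply P (diagonal f) k = 0),
          (uop_deg P <= Nprime d r)%N &
          (uop_ord P)%:R <= Nbound R d r])
  /\
  (forall eps : R, 0 < eps ->
     exists (C : R) (M : nat),
       forall (n' : nat) (d' r' : 'I_n' -> nat),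
         let df := (\max_(i < n') d' i)%N in
         let rf := (\max_(i < n') r' i)%N in
         (M <= n')%N -> (M <= df)%N -> (M <= rf)%N ->
         (Nprime d' r')%:R
           <= C * ((2 + eps) ^+ n' * (n' ^ (2 * n') * df ^ n' * rf ^ n')%N%:R)
         /\
         Nbound R d' r'
           <= C * ((2 + eps) ^+ n' * (n' ^ (2 * n' - 1) * df ^ (n' - 1) * rf ^ n')%N%:R)).
Proof.
move=> K0 n2 _ L0 Lf r d; split; last exact: bounds_asymptotic.
have [P [P0 Pf degP ordP]] := diagonal_operator K0 n2 L0 Lf.
exists P; split=> //.
have D_gt0 : (0 < Dbound d)%N by rewrite muln_gt0 (ltnW n2).
(* The order is bounded by the integer part of [Nprime d r / Dbound d], hence by the quotient
   itself. *)
rewrite /Nbound mulrAC -natrM ler_pdivlMr ?ltr0n // -natrM ler_nat.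
by apply: leq_trans (leq_mul ordP (leqnn _)) (leq_trunc_div _ _).
Qed.
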